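(* Let $d\ge 1$ be an integer and $\sigma=[\sigma_1,\dots,\sigma_d]$ a list of elements of $\{+,-\}$. Identify monic real polynomials of degree $d$ with points of $\mathbb{R}^d$ and put $$W_\sigma=\{P\in\mathbb{R}^d: F_\sigma(P)\ne\emptyset\},\qquad V_\sigma=\{P\in\mathbb{R}^d: U_\sigma(P)\neq\emptyset\}.$$ Then: (1) $W_\sigma$ is a connected and closed $\mathbb{Q}$-semialgebraic set whose interior is $V_\sigma$. (2) $V_\sigma$ is a connected and open $\mathbb{Q}$-semialgebraic set whose closure is $W_\sigma$. (3) For every $P\in W_\sigma$ the set $F_\sigma(P)$ is a non-empty closed interval (possibly reduced to a point), and every finite end-point of $F_\sigma(P)$ is an integral continuous function of $P\in W_\sigma$ and a root of $P^{*}$. (4) Only two cases with an infinite end-point can appear: the right end-point of $F_\sigma(P)$ is $+\infty$ exactly when $\sigma_i=+$ for all $1\le i\le d$, and the left end-point is $-\infty$ exactly when $\sigma_i$ is the sign of $(-1)^i$ for all $1\le i\le d$.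
   Context: A monic real polynomial of degree $d$ is identified with the point of $\mathbb{R}^d$ given by its non-leading coefficients. $P^{[i]}$ denotes the $(d-i)$-th derivative of $P$ divided by its leading coefficient (the monic normalized derivative of degree $i$; $P^{[d]}=P$), and $P^{*}$ is the product of all the $P^{[i]}$. For $\sigma=[\sigma_1,\dots,\sigma_d]$ with $\sigma_i\in\{+,-\}$: $U_\sigma(P)$ is the set of $\alpha\in\mathbb{R}$ such that for each $i=1,\dots,d$, $P^{[i]}(\alpha)>0$ if $\sigma_i=+$ and $P^{[i]}(\alpha)<0$ if $\sigma_i=-$; $F_\sigma(P)$ is the set of $\alpha\in\mathbb{R}$ such that for each $i=1,\dots,d$, $P^{[i]}(\alpha)\ge 0$ if $\sigma_i=+$ and $P^{[i]}(\alpha)\le 0$ if $\sigma_i=-$. A $\mathbb{Q}$-semialgebraic set is one defined by a Boolean combination of polynomial equations and inequalities with rational coefficients. ''Integral continuous function of $P$'' means: continuous, semialgebraic, and annihilated by a monic one-variable polynomial whose coefficients are polynomials in the coefficients of $P$. *)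

(* Defs.v *)
From HB Require Import structures.
From mathcomp Require Import all_boot all_order all_algebra.
From mathcomp Require Import all_classical all_reals all_analysis.
From mathcomp Require mpoly.
Import (canonicals) mpoly.
Import Order.TTheory GRing.Theory Num.Theory.
Import numFieldNormedType.Exports.

Set Implicit Arguments.
Unset Strict Implicit.
Unset Printing Implicit Defensive.

Local Open Scope classical_set_scope.
Local Open Scope ring_scope.

Section Polynomials.
Context {R : realType} {d : nat}.
Implicit Types (v : 'rV[R]_d) (s : d.-tuple bool).

(* [rVpoly v] is the sum of the v_k X^k for k < d. *)
Definition monic_poly v : {poly R} := 'X^d + rVpoly v.

Definition normalized_deriv v (i : nat) : {poly R} :=
  let q := (monic_poly v)^`(d - i) in (lead_coef q)^-1 *: q.

Definition star v : {poly R} := \prod_(1 <= i < d.+1) normalized_deriv v i.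

(* A sign list is a tuple of booleans, [true] standing for + and [false] for -.
   Tuples are indexed from 0: the sign attached to the derivative of degree
   i.+1 is [tnth s i]. *)
Definition Uset s v : set R :=
  [set a | forall i : 'I_d, let x := (normalized_deriv v i.+1).[a] in
           if tnth s i then 0 < x else x < 0].

Definition Fset s v : set R :=
  [set a | forall i : 'I_d, let x := (normalized_deriv v i.+1).[a] in
           if tnth s i then 0 <= x else x <= 0].

Definition Vset s : set 'rV[R]_d := [set v | Uset s v !=set0].

Definition Wset s : set 'rV[R]_d := [set v | Fset s v !=set0].

Definition left_end s v : \bar R := ereal_inf (EFin @` Fset s v).

Definition right_end s v : \bar R := ereal_sup (EFin @` Fset s v).

End Polynomials.

Section Semialgebraic.
Context {R : realType}.

(* Rational polynomials in n variables, i.e. {mpoly rat[n]}; the notations of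
   mpoly clash with those of mathcomp-analysis, hence the qualified names and
   the import of the canonical instances only. *)
Definition ratpoly (n : nat) := mpoly.mpoly n rat.

Definition rateval (n : nat) (v : 'rV[R]_n) (p : ratpoly n) : R :=
  mpoly.mmap (@ratr R) (fun i => v 0 i) p.

Inductive Qsemialgebraic (n : nat) : set 'rV[R]_n -> Prop :=
| Qsemialg_eq (p : ratpoly n) : Qsemialgebraic [set v | rateval v p = 0]
| Qsemialg_gt (p : ratpoly n) : Qsemialgebraic [set v | 0 < rateval v p]
| Qsemialg_setC A : Qsemialgebraic A -> Qsemialgebraic (~` A)
| Qsemialg_setI A B :
    Qsemialgebraic A -> Qsemialgebraic B -> Qsemialgebraic (A `&` B)
| Qsemialg_setU A B :
    Qsemialgebraic A -> Qsemialgebraic B -> Qsemialgebraic (A `|` B).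

(* The graph of the restriction of f to W, in R^(n + 1). *)
Definition graph_on (n : nat) (W : set 'rV[R]_n) (f : 'rV[R]_n -> R) :
    set 'rV[R]_(n + 1) :=
  [set u | W (lsubmx u) /\ rsubmx u 0 0 = f (lsubmx u)].

Definition integral_on (n : nat) (W : set 'rV[R]_n) (f : 'rV[R]_n -> R) :=
  exists2 q : {poly ratpoly n}, q \is monic &
    forall v, W v -> (map_poly (rateval v) q).[f v] = 0.

Definition integral_continuous_on (n : nat) (W : set 'rV[R]_n)
    (f : 'rV[R]_n -> R) :=
  [/\ {within W, continuous f}, Qsemialgebraic (graph_on W f)
    & integral_on W f].

End Semialgebraic.

(* Main.v *)
Require Import Defs.
From HB Require Import structures.
From mathcomp Require Import all_boot all_order all_algebra.
From mathcomp Require Import all_classical all_reals all_analysis.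
From mathcomp Require mpoly.
From mathcomp Require qe_rcf qe_rcf_th polyrcf.
Import (canonicals) mpoly.
Import Order.TTheory GRing.Theory Num.Theory.
Import numFieldNormedType.Exports.

(** Why the theorem is true.

    For a monic P, x lies in F_sigma(P) exactly when the derivatives of P at x
    have the prescribed weak signs, and P is determined freely by x and by those
    derivatives. Most of the statement comes from the freedom that this gives:
    at any point a there is a polynomial u of degree less than d whose
    derivatives at a all have the strict signs sigma ([exists_direction]).

    Topology. When a is in F_sigma(P), adding to P a small positive multiple of
    u moves it into V, so V is dense in W. Subtracting one shows that the
    interior of W is V: if P is interior to W but U_sigma(P) is empty, then
    F_sigma(P) is a single point a, because between two points of F_sigma(P)
    there is always a point of U_sigma(P) ([Uset_between]); the polynomial P - e
    u still has a point x in its F_sigma, x is close to a, and adding e u back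
    makes all the signs at x strict. Connectedness: the polynomials having 0 in
    their F_sigma form a convex set, and every element of W is a translate of
    one of them.

    Compactness. Outside the Cauchy bounds of its derivatives the signs of P are
    those of powers of x, so the part of F_sigma(P) that matters lies in an
    interval that is locally independent of P. On that interval F_sigma is upper
    semicontinuous in P ([near_Fset_subset]), whence W is closed. The
    description of the signs near infinity also gives the criteria for infinite
    end-points.

    Convexity of F_sigma(P) is an induction on the degree: between two points of
    F_sigma(P) each derivative is monotone, since the one of lower degree, to
    which its own derivative is proportional, has constant sign.

    End-points. A finite end-point is an extremal element of the closed interval
    F_sigma(P). It is a root of the product of the derivatives, for otherwise
    F_sigma(P) would extend beyond it; this also gives the monic equation that
    it satisfies. Its continuity combines the upper semicontinuity of F_sigma
    with the openness of the condition that a given point lies in U_sigma(P).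

    Semialgebraicity. Every set in question is a Boolean combination of
    projections, along one variable, of sets defined by sign conditions with
    rational coefficients ([Qsemialgebraic_exists]). The formula that expresses
    the existence of a point with given signs is produced by quantifier
    elimination for real closed fields. That procedure works over an arbitrary
    field of constants, so what has to be checked is that it introduces no
    irrational constant. *)

Set Implicit Arguments.
Unset Strict Implicit.
Unset Printing Implicit Defensive.

Local Open Scope classical_set_scope.
Local Open Scope ring_scope.

(** * Semialgebraic sets and rational quantifier elimination *)

Fixpoint every (T : Type) (P : T -> Prop) (s : seq T) : Prop :=
  if s is x :: s' then P x /\ every P s' else True.

Section RatEval.
Context {R : realType} (n : nat).
Implicit Types (v : 'rV[R]_n).

HB.instance Definition _ v := GRing.RMorphism.copy (rateval v)
  (mpoly.mmap (@ratr R) (fun i => v 0 i)).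

Lemma ratevalC v (c : rat) : rateval v (mpoly.mpolyC n c) = ratr c.
Proof. exact: mpoly.mmapC. Qed.

Lemma ratevalX v i : rateval v (mpoly.mpolyX rat (mpoly.mnm1 i)) = v 0 i.
Proof. by rewrite /rateval mpoly.mmapX mpoly.mmap1U. Qed.

End RatEval.

Section Qsets.
Context {R : realType} (n : nat).

Lemma Qsemialgebraic_set0 : Qsemialgebraic (@set0 'rV[R]_n).
Proof.
suff -> : @set0 'rV[R]_n = [set v | 0 < rateval v 0] by exact: Qsemialg_gt.
by apply/seteqP; split => v //=; rewrite rmorph0 ltxx.
Qed.

Lemma Qsemialgebraic_setT : Qsemialgebraic (@setT 'rV[R]_n).
Proof. by rewrite -setC0; apply: Qsemialg_setC Qsemialgebraic_set0. Qed.

Lemma Qsemialgebraic_bigcup (I : finType) (A : I -> set 'rV[R]_n) :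
  (forall i, Qsemialgebraic (A i)) -> Qsemialgebraic [set v | exists i, A i v].
Proof.
move=> QA; suff -> : [set v | exists i, A i v] =
    \big[setU/set0]_(i <- index_enum I) A i.
  by elim/big_rec: _ => [|i B _ QB];
    [exact: Qsemialgebraic_set0|exact: Qsemialg_setU].
apply/seteqP; split => v /=; first by move=> [i Av]; rewrite (bigD1 i)//=; left.
by elim/big_rec: _ => // i B _ IH [Av|/IH//]; exists i.
Qed.

End Qsets.

Section QElim.
Context {R : realType} (n : nat) (E : seq (ratpoly n)).
Implicit Types (v : 'rV[R]_n).
Local Notation term := (qe_rcf.term R).
Local Notation formula := (qe_rcf.formula R).
Local Notation polyF := (seq term).
Local Notation eval v := (qe_rcf.eval (map (rateval v) E)).
Local Notation qf_eval v := (qe_rcf.qf_eval (map (rateval v) E)).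

(** The variables of a term are interpreted by the values of the rational
    polynomials of the list [E], so that terms and formulas stand for functions
    and subsets of the parameter space. Both predicates are semantic, so that
    terms and formulas need not be compared syntactically with polynomials. *)
Definition ratterm (t : term) := exists p, forall v, eval v t = rateval v p.
Definition ratform (f : formula) := Qsemialgebraic [set v | qf_eval v f].
Local Notation ratpolyF := (every ratterm).

Lemma ratterm_var i : ratterm (qe_rcf.Var R i).
Proof.
exists (E`_i) => v /=.
have [iE|Ei] := ltnP i (size E); first by rewrite (nth_map 0).
by rewrite !nth_default ?size_map// rmorph0.
Qed.

Lemma ratterm_const c : ratterm (qe_rcf.Const (ratr c)).
Proof. by exists (mpoly.mpolyC n c) => v; rewrite ratevalC. Qed.

Lemma ratterm_constz (c : int) : ratterm (qe_rcf.Const c%:~R).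
Proof. by rewrite -ratr_int; apply: ratterm_const. Qed.

Lemma ratterm_nat m : ratterm (qe_rcf.NatConst R m).
Proof. by exists m%:R => v; rewrite rmorph_nat. Qed.

Lemma ratterm_add t u : ratterm t -> ratterm u -> ratterm (qe_rcf.Add t u).
Proof. by move=> [p pE] [q qE]; exists (p + q) => v;
  rewrite rmorphD/= pE qE. Qed.

Lemma ratterm_opp t : ratterm t -> ratterm (qe_rcf.Opp t).
Proof. by move=> [p pE]; exists (- p) => v; rewrite rmorphN/= pE. Qed.

Lemma ratterm_mul t u : ratterm t -> ratterm u -> ratterm (qe_rcf.Mul t u).
Proof. by move=> [p pE] [q qE]; exists (p * q) => v;
  rewrite rmorphM/= pE qE. Qed.

Lemma ratterm_exp t m : ratterm t -> ratterm (qe_rcf.Exp t m).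
Proof. by move=> [p pE]; exists (p ^+ m) => v; rewrite rmorphXn/= pE. Qed.

Hint Resolve ratterm_var ratterm_const ratterm_constz ratterm_nat ratterm_add
  ratterm_opp ratterm_mul ratterm_exp : core.

Lemma ratterm0 : ratterm (qe_rcf.Const 0).
Proof. exact: (ratterm_constz 0). Qed.

Lemma ratterm_N1 : ratterm (qe_rcf.Const (-1)).
Proof. exact: (ratterm_constz (-1)). Qed.
Hint Resolve ratterm0 ratterm_N1 : core.

Lemma ratform_bool b : ratform (qe_rcf.Bool b).
Proof.
case: b; rewrite /ratform /=.
  rewrite (_ : [set _ | _] = setT); first exact: Qsemialgebraic_setT.
  by apply/seteqP; split.
rewrite (_ : [set _ | _] = set0); first exact: Qsemialgebraic_set0.
by apply/seteqP; split.
Qed.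

Lemma ratform_eq0 t : ratterm t ->
  ratform (qe_rcf.Equal t (qe_rcf.NatConst R 0)).
Proof.
move=> [p pE]; rewrite /ratform.
suff -> : [set v | qf_eval v (qe_rcf.Equal t (qe_rcf.NatConst R 0))]
   = [set v | rateval v p = 0] by exact: Qsemialg_eq.
by apply/seteqP; split => v; rewrite /= pE => /eqP.
Qed.

Lemma ratform_lt t u : ratterm t -> ratterm u -> ratform (qe_rcf.Lt t u).
Proof.
move=> [p pE] [q qE]; rewrite /ratform.
suff -> : [set v | qf_eval v (qe_rcf.Lt t u)]
   = [set v | 0 < rateval v (q - p)] by exact: Qsemialg_gt.
by apply/seteqP; split => v; rewrite /= pE qE rmorphB/= subr_gt0.
Qed.

Lemma ratform_and f g : ratform f -> ratform g -> ratform (qe_rcf.And f g).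
Proof.
move=> Qf Qg; rewrite /ratform
  (_ : [set _ | _] = [set v | qf_eval v f] `&` [set v | qf_eval v g]).
  exact: Qsemialg_setI.
by apply/seteqP; split => v /=; [move/andP|move=> [-> ->]].
Qed.

Lemma ratform_or f g : ratform f -> ratform g -> ratform (qe_rcf.Or f g).
Proof.
move=> Qf Qg; rewrite /ratform
  (_ : [set _ | _] = [set v | qf_eval v f] `|` [set v | qf_eval v g]).
  exact: Qsemialg_setU.
by apply/seteqP; split => v /=; [move/orP|move=> [] ->//; rewrite orbT].
Qed.

Lemma ratform_not f : ratform f -> ratform (qe_rcf.Not f).
Proof.
move=> Qf; rewrite /ratform (_ : [set _ | _] = ~` [set v | qf_eval v f]).
  exact: Qsemialg_setC.
by apply/seteqP; split => v /=; [move/negP|move=> /negP].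
Qed.

Lemma ratform_if c f g : ratform c -> ratform f -> ratform g ->
  ratform (qe_rcf.If c f g).
Proof.
move=> Qc Qf Qg; apply: ratform_or; apply: ratform_and => //.
exact: ratform_not.
Qed.

Hint Resolve ratform_bool ratform_eq0 ratform_lt ratform_and ratform_or
  ratform_if : core.

(** The functions of the elimination procedure are written in continuation
    passing style: the case distinctions on the parameters are atoms of the
    formula that they output. Each lemma below says that a step outputs a
    semialgebraic formula as soon as its continuation does on rational
    arguments, which is how rationality goes through the whole procedure. *)
Lemma ratform_Size p k : ratpolyF p -> (forall m, ratform (k m)) ->
  ratform (qe_rcf.Size p k).
Proof.
elim: p k => [|t p IH] k /=; first by move=> _ Qk; exact: Qk.
by move=> [Qt Qp] Qk; apply: IH => // -[|m]; auto.
Qed.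

Lemma ratform_Isnull p k : ratpolyF p -> (forall b, ratform (k b)) ->
  ratform (qe_rcf.Isnull p k).
Proof. by move=> Qp Qk; apply: ratform_Size. Qed.

Lemma ratform_LtSize p q k : ratpolyF p -> ratpolyF q ->
  (forall b, ratform (k b)) ->
  ratform (qe_rcf.LtSize p q k).
Proof. by move=> Qp Qq Qk; apply: ratform_Size => // m;
  apply: ratform_Size. Qed.

Lemma ratform_LeadCoef p k : ratpolyF p -> (forall t, ratterm t ->
  ratform (k t)) ->
  ratform (qe_rcf.LeadCoef p k).
Proof.
elim: p k => [|t p IH] k /=; first by move=> _ Qk; exact: Qk.
by move=> [Qt Qp] Qk; apply: IH => // u Qu; apply: ratform_if; auto.
Qed.

Lemma ratpoly_AmulXn t m : ratterm t -> ratpolyF (qe_rcf.AmulXn t m).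
Proof. by move=> Qt; elim: m => //=. Qed.

Lemma ratpoly_AddPoly p q : ratpolyF p -> ratpolyF q ->
  ratpolyF (qe_rcf.AddPoly p q).
Proof.
elim: p q => [|t p IH] [|u q]//= [Qt Qp] [Qu Qq].
by split; [exact: ratterm_add|exact: IH].
Qed.

Lemma ratpoly_ScalPoly t p : ratterm t -> ratpolyF p ->
  ratpolyF (qe_rcf.ScalPoly t p).
Proof. by move=> Qt; elim: p => //= u p IH [Qu /IH Qp]; split; auto. Qed.
Hint Resolve ratpoly_AddPoly ratpoly_ScalPoly ratpoly_AmulXn : core.

Lemma ratpoly_MulPoly p q : ratpolyF p -> ratpolyF q ->
  ratpolyF (qe_rcf.MulPoly p q).
Proof.
elim: p q => [|t p IH] q//= [Qt Qp] Qq.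
by apply: ratpoly_AddPoly; [exact: ratpoly_ScalPoly|split => //; exact: IH].
Qed.
Hint Resolve ratpoly_MulPoly : core.

Lemma ratpoly_ExpPoly p m : ratpolyF p -> ratpolyF (qe_rcf.ExpPoly p m).
Proof.
move=> Qp; rewrite /qe_rcf.ExpPoly /iterop; case: m => [//|m].
by elim: m => //= m IH; apply: ratpoly_MulPoly.
Qed.

Lemma ratpoly_Deriv p : ratpolyF p -> ratpolyF (qe_rcf.Deriv p).
Proof.
elim: p => //= t p IH [Qt Qp]; apply: ratpoly_AddPoly => //=.
by split => //; exact: IH.
Qed.
Hint Resolve ratpoly_ExpPoly ratpoly_Deriv : core.

Lemma ratform_Rediv_rec_loop q sq cq c qq r m k : ratpolyF q -> ratterm cq ->
  ratpolyF qq -> ratpolyF r ->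
  (forall x, ratpolyF x.1.2 -> ratpolyF x.2 -> ratform (k x)) ->
  ratform (qe_rcf.Rediv_rec_loop q sq cq c qq r m k).
Proof.
move=> Qq Qcq; elim: m c qq r k => [|m IH] c qq r k Qqq Qr Qk /=;
  apply: ratform_Size => // s; case: ifP => _; try exact: Qk;
  apply: ratform_LeadCoef => // l Ql; [apply: Qk|apply: IH] => //=; auto 8.
- by apply: ratpoly_AddPoly; auto; apply: ratpoly_MulPoly => //; split.
- by apply: ratpoly_AddPoly; [apply: ratpoly_MulPoly => //;
  split|apply: ratpoly_ScalPoly; auto].
- by apply: ratpoly_AddPoly; auto; apply: ratpoly_MulPoly => //; split.
- by apply: ratpoly_AddPoly; [apply: ratpoly_MulPoly => //;
  split|apply: ratpoly_ScalPoly; auto].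
Qed.

Lemma ratform_Rediv p q k : ratpolyF p -> ratpolyF q ->
  (forall x, ratpolyF x.1.2 -> ratpolyF x.2 -> ratform (k x)) ->
  ratform (qe_rcf.Rediv p q k).
Proof.
move=> Qp Qq Qk; apply: ratform_Isnull => // -[]; first exact: Qk.
apply: ratform_Size => // sq; apply: ratform_Size => // sp;
  apply: ratform_LeadCoef => // l Ql.
exact: ratform_Rediv_rec_loop.
Qed.

Lemma ratform_Rmod p q k : ratpolyF p -> ratpolyF q ->
  (forall r, ratpolyF r -> ratform (k r)) -> ratform (qe_rcf.Rmod p q k).
Proof. by move=> Qp Qq Qk; apply: ratform_Rediv => // x _; apply: Qk. Qed.

Lemma ratform_Rscal p q k : ratpolyF p -> ratpolyF q ->
  (forall m, ratform (k m)) -> ratform (qe_rcf.Rscal p q k).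
Proof. by move=> Qp Qq Qk; apply: ratform_Rediv. Qed.

Lemma ratform_Rgcd_loop m p q k : ratpolyF p -> ratpolyF q ->
  (forall r, ratpolyF r -> ratform (k r)) -> ratform (qe_rcf.Rgcd_loop m p q k).
Proof.
elim: m p q k => [|m IH] p q k Qp Qq Qk /=; apply: ratform_Rmod => // r Qr;
  apply: ratform_Isnull => // -[]; auto.
Qed.

Lemma ratform_Rgcd p q k : ratpolyF p -> ratpolyF q ->
  (forall r, ratpolyF r -> ratform (k r)) -> ratform (qe_rcf.Rgcd p q k).
Proof.
move=> Qp Qq Qk; apply: ratform_LtSize => // -[];
  apply: ratform_Isnull => // -[]; auto;
  apply: ratform_Size => // m; exact: ratform_Rgcd_loop.
Qed.

Lemma ratform_BigRgcd ps k : every ratpolyF ps ->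
  (forall r, ratpolyF r -> ratform (k r)) -> ratform (qe_rcf.BigRgcd ps k).
Proof.
elim: ps k => [|p ps IH] k /=; first by move=> _; apply.
by move=> [Qp Qps] Qk; apply: IH => // r Qr; apply: ratform_Rgcd.
Qed.

Lemma ratform_Changes s k : ratpolyF s -> (forall m, ratform (k m)) ->
  ratform (qe_rcf.Changes s k).
Proof.
elim: s k => [|t s IH] k /=; first by move=> _; apply.
move=> [Qt Qs] Qk; apply: IH => // m; apply: ratform_if => //.
by apply: ratform_lt => //; apply: ratterm_mul => //; case: s Qs => //= u s [].
Qed.

Lemma ratform_SeqPInfty ps k : every ratpolyF ps ->
  (forall s, ratpolyF s -> ratform (k s)) -> ratform (qe_rcf.SeqPInfty ps k).
Proof.
elim: ps k => [|p ps IH] k /=; first by move=> _; apply.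
move=> [Qp Qps] Qk; apply: ratform_LeadCoef => // l Ql; apply: IH => // s Qs.
exact: Qk.
Qed.

Lemma ratform_SeqMInfty ps k : every ratpolyF ps ->
  (forall s, ratpolyF s -> ratform (k s)) -> ratform (qe_rcf.SeqMInfty ps k).
Proof.
elim: ps k => [|p ps IH] k /=; first by move=> _; apply.
move=> [Qp Qps] Qk; apply: ratform_LeadCoef => // l Ql;
  apply: ratform_Size => // m.
by apply: IH => // s Qs; apply: Qk; split; auto.
Qed.

Lemma ratform_ChangesPoly ps k : every ratpolyF ps ->
  (forall m, ratform (k m)) -> ratform (qe_rcf.ChangesPoly ps k).
Proof.
move=> Qps Qk; apply: ratform_SeqMInfty => // s Qs;
  apply: ratform_SeqPInfty => // t Qt.
by apply: ratform_Changes => // m; apply: ratform_Changes.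
Qed.

Lemma ratform_NextMod p q k : ratpolyF p -> ratpolyF q ->
  (forall r, ratpolyF r -> ratform (k r)) -> ratform (qe_rcf.NextMod p q k).
Proof.
move=> Qp Qq Qk; apply: ratform_LeadCoef => // l Ql;
  apply: ratform_Rscal => // m.
by apply: ratform_Rmod => // r Qr; apply: Qk; apply: ratpoly_ScalPoly; auto.
Qed.

Lemma ratform_Mods p q k : ratpolyF p -> ratpolyF q ->
  (forall s, every ratpolyF s -> ratform (k s)) -> ratform (qe_rcf.Mods p q k).
Proof.
move=> Qp Qq Qk; apply: ratform_Size => // sp; apply: ratform_Size => // sq.
elim: (maxn _ _) p q k Qp Qq Qk => [|m IH] p q k Qp Qq Qk /=; first exact: Qk.
apply: ratform_Isnull => // -[]; first exact: Qk.
apply: ratform_NextMod => // r Qr; apply: IH => // s Qs; exact: Qk.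
Qed.

Lemma ratpoly_Pcq sq i : every ratpolyF sq -> ratpolyF (qe_rcf.Pcq sq i).
Proof.
move=> Qsq; rewrite /qe_rcf.Pcq;
  elim: (qe_rcf_th.sg_tab _) i => [|sc s IH] [|i]//=.
rewrite /qe_rcf.PolyComb; elim: (iota _ _) => //= j l IHl.
apply: ratpoly_MulPoly => //; apply: ratpoly_ExpPoly.
by elim: sq j Qsq {IH IHl} => [|p sq IH] [|j]//= [Qp Qsq]; auto.
Qed.

Lemma ratform_TaqsR p sq i k : ratpolyF p -> every ratpolyF sq ->
  (forall t, ratterm t -> ratform (k t)) -> ratform (qe_rcf.TaqsR p sq i k).
Proof.
move=> Qp Qsq Qk; apply: ratform_Mods => // [|s Qs].
  by apply: ratpoly_MulPoly; [exact: ratpoly_Deriv|exact: ratpoly_Pcq].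
by apply: ratform_ChangesPoly => // m; apply: Qk.
Qed.

(** These are the only constants that are not visibly integers: entries of the
    inverse of an integer matrix, which is already invertible over [rat]. *)
Lemma ratterm_Coefs m i : ratterm (qe_rcf.Coefs R m i).
Proof.
suff [c cE] : exists c : rat,
  qe_rcf.Coefs R m i = qe_rcf.Const (ratr c) by rewrite cE.
rewrite /qe_rcf.Coefs; case: m => [|[|m]].
- by exists (i == 0%N)%:R; rewrite ratr_nat.
- case: i => [|[|i]]/=; [exists (2^-1)|exists (2^-1)|exists 0].
  + by congr qe_rcf.Const; rewrite [RHS]fmorphV rmorph_nat.
  + by congr qe_rcf.Const; rewrite [RHS]fmorphV rmorph_nat.
  + by congr qe_rcf.Const; rewrite [RHS]rmorph0; case: i => [|i] /=;
    rewrite ?nth_nil.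
exists (qe_rcf_th.coefs rat m.+2 i); congr qe_rcf.Const;
  rewrite /qe_rcf_th.coefs.
set M := castmx _ _; set N := castmx _ _.
have -> : M = map_mx ratr N.
  rewrite /M /N map_castmx map_invmx; congr (castmx _ (invmx _)).
  by rewrite -map_mx_comp; apply: eq_map_mx => z /=; rewrite ratr_int.
have [ilt|ige] := ltnP i (size (enum 'I_(3 ^ m.+2))).
  have x0 : 'I_(3 ^ m.+2) by rewrite size_enum_ord in ilt; exact: Ordinal ilt.
  by rewrite !(nth_map x0 0 _ ilt) mxE.
by rewrite !nth_default ?size_map ?rmorph0 -?enumT.
Qed.

Lemma ratform_CcountWeak p sq k : ratpolyF p -> every ratpolyF sq ->
  (forall t, ratterm t -> ratform (k t)) -> ratform (qe_rcf.CcountWeak p sq k).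
Proof.
move=> Qp Qsq Qk; rewrite /qe_rcf.CcountWeak.
have : ratterm (qe_rcf.NatConst R 0) by [].
elim: (3 ^ _)%N (qe_rcf.NatConst R 0) => [|i IH] t Qt; first exact: Qk.
apply: ratform_TaqsR => // u Qu; apply: IH; apply: ratterm_add => //.
by apply: ratterm_mul => //; exact: ratterm_Coefs.
Qed.

Lemma ratform_CcountGt0 sp sq : every ratpolyF sp -> every ratpolyF sq ->
  ratform (qe_rcf.CcountGt0 sp sq).
Proof.
move=> Qsp Qsq; apply: ratform_BigRgcd => // p Qp;
  apply: ratform_Isnull => // -[] /=; last first.
  by apply: ratform_CcountWeak => // t Qt; exact: ratform_lt.
apply: ratform_CcountWeak => // [|t Qt].
  by apply: ratpoly_Deriv; elim: sq Qsq => //= q sq IH [Qq /IH Qsq];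
    exact: ratpoly_MulPoly.
apply: ratform_or; last apply: ratform_or; last exact: ratform_lt.
  elim: sq Qsq => //= q sq IH [Qq /IH Qsq]; apply: ratform_and => //.
  by apply: ratform_LeadCoef => // l Ql; exact: ratform_lt.
elim: sq Qsq => //= q sq IH [Qq /IH Qsq]; apply: ratform_and => //.
apply: ratform_Size => // m; apply: ratform_LeadCoef => // l Ql;
  apply: ratform_lt => //.
by apply: ratterm_mul => //; apply: ratterm_exp; auto.
Qed.

End QElim.

Section Projection.
Context {R : realType} (n : nat).
Implicit Types (v : 'rV[R]_n).

(** * Projections of rational semialgebraic sets along a line *)

(** The coefficients of the given polynomials are themselves taken as the
    variables of the eliminated formula. *)
Lemma Qsemialgebraic_exists_root_pos (P Q : seq {poly ratpoly n}) :
  Qsemialgebraic [set v : 'rV[R]_n | exists x,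
    (forall p, p \in P -> (map_poly (rateval v) p).[x] = 0) /\
    (forall q, q \in Q -> 0 < (map_poly (rateval v) q).[x])].
Proof.
pose E : seq (ratpoly n) := flatten (map polyseq (P ++ Q)).
pose tm (p : {poly ratpoly n}) := [seq qe_rcf.Var R (index c E) | c <- p].
have tmE v (p : {poly ratpoly n}) : p \in P ++ Q ->
    qe_rcf.eval_poly (map (rateval v) E) (tm p) = map_poly (rateval v) p.
  move=> pPQ; rewrite qe_rcf.eval_polyP map_polyE /tm -map_comp; congr Poly.
  apply/eq_in_map => c cp /=.
  have cE : c \in E by apply/flattenP; exists (polyseq p) => //; apply: map_f.
  by rewrite (nth_map 0) ?index_mem// nth_index.
have tmrat s : every (every (@ratterm R n E)) (map tm s).
  elim: s => //= p s IH; split => //; rewrite /tm.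
  by elim: (polyseq p) => //= c l IHl; split => //; exact: ratterm_var.
have := ratform_CcountGt0 (tmrat P) (tmrat Q); rewrite /ratform.
set A := [set _ | _]; set B := [set _ | _]; suff -> : A = B by [].
have evE v s : {subset s <= P ++ Q} ->
   map (qe_rcf.eval_poly (map (rateval v) E)) (map tm s) =
   map (map_poly (rateval v)) s.
  by move=> sPQ; rewrite -map_comp; apply/eq_in_map => p /sPQ pPQ; exact: tmE.
have PPQ : {subset P <= P ++ Q} by move=> p; rewrite mem_cat => ->.
have QPQ : {subset Q <= P ++ Q} by move=> p; rewrite mem_cat orbC => ->.
apply/seteqP; split => v; rewrite /A /B /= qe_rcf.eval_CcountGt0 !evE//.
  move=> /qe_rcf_th.ccount_gt0P[x];
    rewrite !big_map !big_all => /andP[/allP hP /allP hQ].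
  by exists x; split => [p /hP/eqP ->//|q /hQ//].
move=> [x [hP hQ]]; apply/qe_rcf_th.ccount_gt0P; exists x.
by rewrite !big_map !big_all; apply/andP; split; apply/allP => p;
  [move/hP/eqP|exact: hQ].
Qed.

(** A weak inequality is an equality or a strict inequality, so the set is a
    finite union over the subset [Z] of indices where equality holds. *)
Lemma Qsemialgebraic_exists (I J : finType) (p : I -> {poly ratpoly n})
    (q : J -> {poly ratpoly n}) :
  Qsemialgebraic [set v : 'rV[R]_n | exists x,
    (forall i, 0 <= (map_poly (rateval v) (p i)).[x]) /\
    (forall j, 0 < (map_poly (rateval v) (q j)).[x])].
Proof.
have := @Qsemialgebraic_bigcup R n {set I} _ (fun Z =>
  Qsemialgebraic_exists_root_pos [seq p i | i in Z]
    ([seq p i | i in ~: Z] ++ [seq q j | j : J])).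
set A := [set _ | _]; set B := [set _ | _]; suff -> : A = B by [].
apply/seteqP; split => v; rewrite /A /B /=.
  move=> [Z [x [hP hQ]]]; exists x; split => [i|j].
    have [iZ|iZ] := boolP (i \in Z); first by rewrite hP // fintype.image_f.
    by apply/ltW/hQ; rewrite mem_cat fintype.image_f// inE.
  by apply: hQ; rewrite mem_cat orbC fintype.image_f.
move=> [x [hP hQ]].
exists [set i | (map_poly (rateval v) (p i)).[x] == 0]%SET, x; split => [r|r].
  by move=> /fintype.imageP[i]; rewrite inE => /eqP ? ->.
rewrite mem_cat => /orP[|] /fintype.imageP[i iZ ->]; last exact: hQ.
by rewrite lt_neqAle hP andbT eq_sym; move: iZ; rewrite !inE.
Qed.

End Projection.

(** * Normalized derivatives *)

Section MonicDerivative.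
Variables (A : comNzRingType) (d : nat).
Implicit Types (w : 'rV[A]_d).

(** The polynomial [monic_poly], over any commutative ring: it is also needed
    over the ring of rational polynomials in the coefficients. *)
Definition gmonic w : {poly A} := 'X^d + rVpoly w.

Lemma size_gmonic w : size (gmonic w) = d.+1.
Proof. by rewrite size_polyDl size_polyXn// ltnS size_poly. Qed.

Lemma monic_gmonic w : gmonic w \is monic.
Proof.
by rewrite monicE lead_coefDl ?lead_coefXn// size_polyXn ltnS size_poly.
Qed.

Lemma coef_gmonic w (k : 'I_d) : (gmonic w)`_k = w 0 k.
Proof. by rewrite coefD coefXn ltn_eqF// add0r coef_rVpoly_ord. Qed.

Lemma gmonic_inj : injective gmonic.
Proof. by move=> w w' ww'; apply/rowP => k; rewrite -!coef_gmonic ww'. Qed.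

Lemma gmonic_surj (p : {poly A}) : p \is monic -> size p = d.+1 ->
  exists w, p = gmonic w.
Proof.
move=> pm ps; exists (poly_rV p); apply/polyP => k.
rewrite coefD coefXn coef_rVpoly; case: insubP => [i id ik|];
  first by rewrite mxE ltn_eqF// add0r ik.
rewrite -leqNgt addr0 leq_eqVlt => /orP[/eqP <-|dk].
  by rewrite eqxx; move: pm; rewrite monicE lead_coefE ps => /eqP.
by rewrite gtn_eqF// nth_default// ps.
Qed.

Variables (p : {poly A}) (i : nat) (c : A).
Hypotheses (pm : p \is monic) (ps : size p = d.+1) (id : (i <= d)%N)
  (cE : c * (d ^_ (d - i))%:R = 1).

Lemma coef_scaled_derivn : (c *: p^`(d - i))`_i = 1.
Proof.
rewrite coefZ coef_derivn subnK// -mulr_natr mulrCA cE mulr1.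
by move: pm; rewrite monicE lead_coefE ps => /eqP.
Qed.

Lemma size_scaled_derivn : size (c *: p^`(d - i)) = i.+1.
Proof.
apply/eqP; rewrite eqn_leq; apply/andP; split; last first.
  rewrite ltnNge; apply/negP => /leq_sizeP/(_ i (leqnn i)).
  by rewrite coef_scaled_derivn => /eqP; rewrite oner_eq0.
apply/leq_sizeP => j ij; rewrite coefZ coef_derivn nth_default ?mul0rn ?mulr0//.
by rewrite ps (leq_trans _ (leq_add (leqnn _) ij))// addnS subnK.
Qed.

Lemma monic_scaled_derivn : c *: p^`(d - i) \is monic.
Proof. by rewrite monicE lead_coefE size_scaled_derivn coef_scaled_derivn. Qed.

End MonicDerivative.

Lemma ffact_neq0 (F : numDomainType) d i : (d ^_ (d - i))%:R != 0 :> F.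
Proof. by rewrite pnatr_eq0 -lt0n ffact_gt0 leq_subr. Qed.

Section NormalizedDeriv.
Context {R : realType} {d : nat}.
Implicit Types (v : 'rV[R]_d).

Lemma normalized_derivE v i : (i <= d)%N ->
  normalized_deriv v i = (d ^_ (d - i))%:R^-1 *: (monic_poly v)^`(d - i).
Proof.
move=> id; rewrite /normalized_deriv; congr (_^-1 *: _).
have c0 := ffact_neq0 R d i.
have := monic_scaled_derivn (monic_gmonic v) (size_gmonic v) id (mulVf c0).
by rewrite monicE lead_coefZ => /eqP cl; apply: (mulfI (invr_neq0 c0));
  rewrite cl mulVf.
Qed.

Lemma monic_normalized_deriv v i : (i <= d)%N -> normalized_deriv v i \is monic.
Proof.
move=> id; rewrite normalized_derivE//.
exact: monic_scaled_derivn (monic_gmonic v) (size_gmonic v) id (mulVf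
  (ffact_neq0 R d i)).
Qed.

Lemma size_normalized_deriv v i : (i <= d)%N ->
  size (normalized_deriv v i) = i.+1.
Proof.
move=> id; rewrite normalized_derivE//.
exact: size_scaled_derivn (monic_gmonic v) (size_gmonic v) id (mulVf
  (ffact_neq0 R d i)).
Qed.

Lemma deriv_normalized_deriv v i : (i < d)%N ->
  (normalized_deriv v i.+1)^`() = i.+1%:R *: normalized_deriv v i.
Proof.
move=> id; rewrite !normalized_derivE// ?(ltnW id)// derivZ -derivnS -subSn//
  subSS.
rewrite scalerA; congr (_ *: _).
by rewrite -[in RHS](subnSK id) ffactnSr natrM subKn// invfM mulrCA mulfV
  ?mulr1.
Qed.

End NormalizedDeriv.

Section Generic.
Context {R : realType} {d n : nat} (h : 'I_d -> 'I_n).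
Implicit Types (v : 'rV[R]_n).

(** The polynomial whose coefficients are indeterminates. The embedding [h] of
    the indices leaves room for one more variable, used for the graphs of the
    end-points. *)
Definition generic_poly : {poly ratpoly n} :=
  gmonic (\row_k mpoly.mpolyX rat (mpoly.mnm1 (h k))).

Definition generic_deriv i : {poly ratpoly n} :=
  mpoly.mpolyC n ((d ^_ (d - i))%:R^-1) *: generic_poly^`(d - i).

Lemma monic_generic_deriv i : (i <= d)%N -> generic_deriv i \is monic.
Proof.
move=> id; apply: monic_scaled_derivn (monic_gmonic _) (size_gmonic _) id _.
by rewrite -(rmorph_nat (@mpoly.mpolyC n rat)) -rmorphM mulVf ?rmorph1//
  ffact_neq0.
Qed.

Lemma map_generic_deriv v i : (i <= d)%N ->
  map_poly (rateval v) (generic_deriv i) =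
  normalized_deriv (\row_k v 0 (h k)) i.
Proof.
move=> id; rewrite normalized_derivE// map_polyZ/= -derivn_map ratevalC.
rewrite [ratr _]fmorphV rmorph_nat.
congr (_ *: _^`(_));
  rewrite /generic_poly /gmonic rmorphD/= map_polyXn map_rVpoly.
by congr (_ + rVpoly _); apply/rowP => k; rewrite !mxE; exact: ratevalX.
Qed.

End Generic.

(** * Signed derivatives, their continuity and their signs near infinity *)

Lemma continuous_mul (R : realType) (T : topologicalType) (f g : T -> R) :
  continuous f -> continuous g -> continuous (fun x => f x * g x).
Proof. by move=> cf cg x; exact: (continuousM (cf x) (cg x)). Qed.

Lemma continuous_add (R : realType) (T : topologicalType) (f g : T -> R) :
  continuous f -> continuous g -> continuous (fun x => f x + g x).
Proof. by move=> cf cg x; exact: (continuousD (cf x) (cg x)). Qed.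

Lemma continuous_cst (R : realType) (T : topologicalType) (c : R) :
  continuous (fun _ : T => c).
Proof. by move=> x; exact: cvg_cst. Qed.

Lemma continuous_abs (R : realType) (T : topologicalType) (f : T -> R) :
  continuous f -> continuous (fun x => `|f x|).
Proof. by move=> cf x; exact: (cvg_norm (cf x)). Qed.

Section SignedDeriv.
Context {R : realType} {d : nat} (s : d.-tuple bool).
Implicit Types (v u : 'rV[R]_d) (i : 'I_d).

Definition sgn (b : bool) : R := if b then 1 else -1.

Lemma sgn_neq0 b : sgn b != 0.
Proof. by case: b; rewrite /sgn ?oppr_eq0 oner_eq0. Qed.

Lemma normr_sgn b : `|sgn b| = 1.
Proof. by case: b; rewrite /sgn ?normrN normr1. Qed.

Lemma sgnK b x : sgn b * (sgn b * x) = x.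
Proof. by case: b; rewrite /sgn ?mul1r// !mulN1r opprK. Qed.

(** Multiplying by the prescribed sign turns the conditions that define [Uset]
    and [Fset] into positivity conditions. *)
Definition sderiv v i : {poly R} := sgn (tnth s i) *: normalized_deriv v i.+1.

Lemma sderivE v i x :
  (sderiv v i).[x] = sgn (tnth s i) * (normalized_deriv v i.+1).[x].
Proof. by rewrite hornerZ. Qed.

Lemma UsetP v x : Uset s v x <-> forall i, 0 < (sderiv v i).[x].
Proof.
rewrite /Uset /=; split => U i; have := U i; rewrite sderivE /sgn;
  by case: (tnth s i); rewrite ?mul1r ?mulN1r ?oppr_gt0.
Qed.

Lemma FsetP v x : Fset s v x <-> forall i, 0 <= (sderiv v i).[x].
Proof.
rewrite /Fset /=; split => F i; have := F i; rewrite sderivE /sgn;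
  by case: (tnth s i); rewrite ?mul1r ?mulN1r ?oppr_ge0.
Qed.

Lemma Uset_sub_Fset v : Uset s v `<=` Fset s v.
Proof. by move=> x /UsetP Ux; apply/FsetP => i; apply/ltW. Qed.

Lemma Uset_nonroot v x :
  Fset s v x -> (forall i, ~~ root (normalized_deriv v i.+1) x) -> Uset s v x.
Proof.
move=> /FsetP Fx r; apply/UsetP => i; rewrite lt_neqAle Fx andbT eq_sym sderivE.
by rewrite mulf_neq0 ?sgn_neq0//; exact: r.
Qed.

Lemma continuous_coef_normalized_deriv (k j : nat) : (k <= d)%N ->
  continuous (fun v : 'rV[R]_d => (normalized_deriv v k)`_j).
Proof.
move=> kd.
rewrite (_ : (fun _ => _) = fun v : 'rV[R]_d => (d ^_ (d - k))%:R^-1 *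
    ((d - k + j == d)%N%:R + (if insub (d - k + j)%N is Some i
      then v 0 i else 0)) *
      ((d - k + j) ^_ (d - k))%:R); last first.
  apply/funext => w; rewrite normalized_derivE// coefZ coef_derivn.
  by rewrite coefD coefXn coef_rVpoly -mulrA mulr_natr.
apply: continuous_mul; last exact: continuous_cst.
apply: continuous_mul; first exact: continuous_cst.
apply: continuous_add; first exact: continuous_cst.
by case: insub => [i|]; [exact: coord_continuous|exact: continuous_cst].
Qed.

Lemma continuous_normalized_deriv (k : nat) : (k <= d)%N ->
  continuous (fun z : R * 'rV[R]_d => (normalized_deriv z.2 k).[z.1]).
Proof.
move=> kd; rewrite (_ : (fun _ => _) = fun z : R * 'rV[R]_d =>
   \sum_(j < k.+1) (normalized_deriv z.2 k)`_j * z.1 ^+ j); last first.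
  by apply/funext => z; rewrite horner_coef size_normalized_deriv.
apply: continuous_big => [|j _]; first exact: add_continuous.
apply: continuous_mul => z.
  apply: (@continuous_comp _ _ _ snd (fun v => (normalized_deriv v k)`_j)).
    exact: cvg_snd.
  exact: continuous_coef_normalized_deriv.
apply: (@continuous_comp _ _ _ fst (fun x : R => x ^+ j)); first exact: cvg_fst.
exact: exprn_continuous.
Qed.

Lemma continuous_sderiv i :
  continuous (fun z : R * 'rV[R]_d => (sderiv z.2 i).[z.1]).
Proof.
rewrite (_ : (fun _ => _) = fun z : R * 'rV[R]_d =>
  sgn (tnth s i) * (normalized_deriv z.2 i.+1).[z.1]); last first.
  by apply/funext => w; rewrite sderivE.
by apply: continuous_mul;
  [exact: continuous_cst|exact: continuous_normalized_deriv].
Qed.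

(** Any continuous function of [v] that bounds all the roots would do. *)
Definition root_bound v : R :=
  \sum_(i < d) polyrcf.cauchy_bound (normalized_deriv v i.+1).

Lemma cauchy_le_root_bound v i :
  polyrcf.cauchy_bound (normalized_deriv v i.+1) <= root_bound v.
Proof.
rewrite /root_bound (bigD1 i)//= lerDl sumr_ge0// => j _.
exact: polyrcf.cauchy_bound_ge0.
Qed.

Lemma normalized_deriv_neq0 v i : normalized_deriv v i.+1 != 0.
Proof. exact/monic_neq0/monic_normalized_deriv. Qed.

Lemma root_le_root_bound v i x :
  root (normalized_deriv v i.+1) x -> `|x| <= root_bound v.
Proof.
move=> /rootP /(polyrcf.cauchy_boundP (normalized_deriv_neq0 v i)).
move=> /ltW /le_trans; apply.
exact: cauchy_le_root_bound.
Qed.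

Lemma normalized_deriv_right_gt0 v i x : root_bound v <= x ->
  0 < (normalized_deriv v i.+1).[x].
Proof.
move=> vx; rewrite -sgr_gt0.
have nz := normalized_deriv_neq0 v i.
rewrite (polyrcf.sgp_pinftyP (polyrcf.ge_cauchy_bound nz)).
  rewrite /polyrcf.sgp_pinfty (eqP (_ : lead_coef _ == 1)) ?sgr1//.
  by rewrite -monicE monic_normalized_deriv.
by rewrite in_itv/= andbT (le_trans (cauchy_le_root_bound v i)).
Qed.

Lemma normalized_deriv_left_sign v i x : x <= - root_bound v ->
  0 < (-1) ^+ i.+1 * (normalized_deriv v i.+1).[x].
Proof.
move=> vx; rewrite -sgr_gt0 sgrM.
have nz := normalized_deriv_neq0 v i.
rewrite (polyrcf.sgp_minftyP (polyrcf.le_cauchy_bound nz)).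
  rewrite /polyrcf.sgp_minfty size_normalized_deriv//.
  rewrite (eqP (_ : lead_coef _ == 1)).
    by rewrite mulr1 -sgrM -exprD addnn -mul2n exprM sqrrN expr1n expr1n sgr1.
  by rewrite -monicE monic_normalized_deriv.
by rewrite in_itv/= (le_trans vx)// lerN2 cauchy_le_root_bound.
Qed.

Lemma continuous_root_bound : continuous root_bound.
Proof.
apply: continuous_big => [|i _]; first exact: add_continuous.
rewrite (_ : (fun _ => _) = fun v : 'rV[R]_d =>
  1 + \sum_(j < i.+2) `|(normalized_deriv v i.+1)`_j|); last first.
  apply/funext => v; rewrite /polyrcf.cauchy_bound size_normalized_deriv//.
  rewrite (eqP (_ : lead_coef _ == 1)) ?normr1 ?invr1 ?mul1r//.
  by rewrite -monicE monic_normalized_deriv.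
apply: continuous_add; first exact: continuous_cst.
apply: continuous_big => [|j _]; first exact: add_continuous.
by apply: continuous_abs; exact: continuous_coef_normalized_deriv.
Qed.

Lemma Fset_right_signs v x : Fset s v x -> root_bound v <= x ->
  forall i, tnth s i = true.
Proof.
move=> /FsetP Fx vx i; have := Fx i; rewrite sderivE; case: (tnth s i) => //.
by rewrite mulN1r oppr_ge0 leNgt normalized_deriv_right_gt0.
Qed.

Lemma Fset_left_signs v x : Fset s v x -> x <= - root_bound v ->
  forall i, tnth s i = ~~ odd i.+1.
Proof.
move=> /FsetP Fx vx i; have := Fx i; have := normalized_deriv_left_sign i vx;
  rewrite sderivE.
rewrite -signr_odd; case: (odd _); case: (tnth s i);
  rewrite /sgn //= ?expr0 ?expr1 ?mul1r ?mulN1r ?oppr_ge0 ?oppr_gt0.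
  by move=> /lt_geF ->.
by move=> /lt_geF ->.
Qed.

Lemma Fset_right_ray v x : (forall i, tnth s i = true) -> root_bound v <= x ->
  Fset s v x.
Proof.
move=> sT vx; apply/FsetP => i; rewrite sderivE sT mul1r ltW//;
  exact: normalized_deriv_right_gt0.
Qed.

Lemma Fset_left_ray v x : (forall i, tnth s i = ~~ odd i.+1) ->
  x <= - root_bound v -> Fset s v x.
Proof.
move=> sT vx; apply/FsetP => i; rewrite sderivE sT ltW//; have :=
  normalized_deriv_left_sign i vx.
by rewrite -signr_odd; case: (odd _).
Qed.

(** Beyond [root_bound] the signs no longer change, so a point of [Fset] lying
    there can be brought back to [M] or [- M]. *)
Lemma Fset_bounded v x M : Fset s v x -> root_bound v <= M ->
  exists2 y, Fset s v y & y \in `[- M, M].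
Proof.
move=> Fx vM.
have M0 : 0 <= M by rewrite (le_trans _ vM)// sumr_ge0// => i _;
  exact: polyrcf.cauchy_bound_ge0.
have NMM : - M <= M by rewrite (le_trans _ M0)// oppr_le0.
have [Mx|xM] := leP M x.
  by exists M; rewrite ?in_itv/= ?lexx ?NMM//; apply: Fset_right_ray => //;
    exact: Fset_right_signs Fx (le_trans vM Mx).
have [Mx|Mx] := leP x (- M).
  exists (-M); rewrite ?in_itv/= ?lexx ?NMM//.
  apply: Fset_left_ray; last by rewrite lerN2.
  by apply: Fset_left_signs Fx (le_trans Mx _); rewrite lerN2.
by exists x => //; rewrite in_itv/= !ltW.
Qed.

Lemma closed_Fset v : closed (Fset s v).
Proof.
rewrite (_ : Fset s v =
    \bigcap_(i in [set: 'I_d]) [set x | 0 <= (sderiv v i).[x]]).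
  apply: closed_bigI => i _;
    apply: (@closed_comp _ _ (horner (sderiv v i)) [set y | 0 <= y]).
    by move=> x _; exact: continuous_horner.
  exact: closed_ge.
by apply/seteqP; split => x /= => [/FsetP Fx i _|Fx];
  [exact: Fx|apply/FsetP => i; exact: Fx].
Qed.

(** A monotone function is bounded below on an interval by its value at one of
    the ends. *)
Lemma horner_ge0_between (p : {poly R}) x y z : x <= y <= z ->
  (forall t, x <= t <= z -> 0 <= p^`().[t]) \/
  (forall t, x <= t <= z -> p^`().[t] <= 0) ->
  0 <= p.[x] -> 0 <= p.[z] -> 0 <= p.[y].
Proof.
move=> /andP[xy yz] dp px pz; have xz := le_trans xy yz.
have inxz t : t \in `]x, z[ -> x <= t <= z.
  by rewrite in_itv/= => /andP[/ltW-> /ltW->].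
have [xI yI zI] : [/\ x \in `[x, z], y \in `[x, z] & z \in `[x, z]].
  by rewrite !in_itv/= !lexx xy yz xz.
case: dp => dp; first apply: (le_trans px); last apply: (le_trans pz).
  by apply: (@polyrcf.ler_hornerW _ x z) => // t /inxz; exact: dp.
rewrite -lerN2 -!hornerN.
apply: (@polyrcf.ler_hornerW _ x z) => // t /inxz;
  rewrite derivN hornerN oppr_ge0; exact: dp.
Qed.

(** Between [x] and [z] the derivative of degree [k] has a constant weak sign;
    the one of degree [k.+1] is therefore monotone there and keeps the sign that
    it has at [x] and [z]. *)
Lemma is_interval_Fset v : is_interval (Fset s v).
Proof.
move=> x z /FsetP Fx /FsetP Fz y xyz.
(* The extra initial sign is that of the derivative of degree 0, which is 1. *)
suff H k : (k <= d)%N -> forall t, x <= t <= z ->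
    0 <= sgn (nth true (true :: s) k) * (normalized_deriv v k).[t].
  by apply/FsetP => i; have := H i.+1 (ltn_ord i) y xyz;
    rewrite /= -tnth_nth -sderivE.
elim: k => [_ t _|k IH kd t xtz].
  have /eqP/size_poly1P[c c0 nE] := size_normalized_deriv v (leq0n d).
  have := monic_normalized_deriv v (leq0n d).
  by rewrite nE monicE lead_coefC => /eqP ->; rewrite hornerC mul1r ler01.
pose i := Ordinal kd.
rewrite /= -(@tnth_nth _ _ _ _ i) -(sderivE v i).
apply: (horner_ge0_between xtz) => //.
have [q dE q0] : exists2 q : R -> R, (forall u : R, (sderiv v i)^`().[u] =
    (sgn (tnth s i) * sgn (nth true (true :: s) k)) * q u) &
    forall u : R, x <= u <= z -> 0 <= q u.
  exists (fun u : R =>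
    k.+1%:R * (sgn (nth true (true :: s) k) * (normalized_deriv v k).[u])) => u.
    rewrite derivZ deriv_normalized_deriv// !hornerZ -mulrA; congr (_ * _).
    by rewrite [RHS]mulrCA sgnK.
  by move=> /IH H; rewrite mulr_ge0// H// ltnW.
case: (tnth s i) (nth _ _ k) dE => [] [] dE; [left|right|right|left] => u /q0;
  by rewrite dE /sgn ?mulrNN ?mulrN ?mul1r ?mulN1r ?oppr_le0.
Qed.

End SignedDeriv.

(** * Semicontinuity of the set of points with given weak signs *)

Section Topology.
Context {R : realType} {d : nat} (s : d.-tuple bool).
Implicit Types (v u : 'rV[R]_d) (i : 'I_d) (x y : R).

Lemma near_sderiv_gt0 v i x : 0 < (sderiv s v i).[x] ->
  \forall y \near x & w \near v, 0 < (sderiv s w i).[y].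
Proof.
move=> h; have /= := @continuous_sderiv R d s i (x, v).
by move=> /cvgr_gt; apply.
Qed.

Lemma near_Uset v x : Uset s v x -> \forall y \near x & w \near v, Uset s w y.
Proof.
move=> /UsetP U.
have := @filter_forall _ _ (fun i (z : R * 'rV[R]_d) =>
  0 < (sderiv s z.2 i).[z.1])
  (filter_prod (nbhs x) (nbhs v)) (@filter_prod_filter _ _ _ _ _ _) (fun i =>
    near_sderiv_gt0 (U i)).
by move=> /(_ _ _); apply: filterS => z Uz; apply/UsetP.
Qed.

Lemma near_param_Uset v x : Uset s v x -> \forall w \near v, Uset s w x.
Proof.
move=> /near_Uset[[A B]] /= [Ax Bv] AB; apply: filterS Bv => w Bw.
by apply: (AB (x, w)); split => //=; exact: nbhs_singleton.
Qed.

Lemma near_point_Uset v x : Uset s v x -> \forall y \near x, Uset s v y.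
Proof.
move=> /near_Uset[[A B]] /= [Ax Bv] AB; apply: filterS Ax => y Ay.
by apply: (AB (y, v)); split => //=; exact: nbhs_singleton.
Qed.

Lemma near_root_bound v : \forall w \near v, root_bound w <= root_bound v + 1.
Proof.
have := @continuous_root_bound R d v => /cvgr_le; apply.
by rewrite ltrDl.
Qed.

(** Upper semicontinuity, by compactness of the interval: at a point [x] that is
    not in [Fset s v] some derivative has the wrong strict sign, and keeps it
    when both [x] and the polynomial move a little. *)
Lemma near_Fset_subset v (N : set R) M : open N -> Fset s v `<=` N ->
  \forall w \near v, forall x, x \in `[- M, M] -> Fset s w x -> N x.
Proof.
move=> oN FN.
have := @segment_compact R (- M) M => /compact_near_coveringP.
move=> /(_ _ (nbhs v) (fun w x => Fset s w x -> N x) _); apply => x _.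
have [Fx|nFx] := pselect (Fset s v x).
  have : nbhs x N by apply: open_nbhs_nbhs; split => //; exact: FN.
  move=> Nx; exists (N, setT); first by split => //; exact: filterT.
  by move=> [y w] /= [].
have [i xi] : exists i, (sderiv s v i).[x] < 0.
  apply: contrapT => h; apply: nFx; apply/FsetP => i; rewrite leNgt;
    apply/negP => xi.
  by apply: h; exists i.
have /= := @continuous_sderiv R d s i (x, v) => /cvgr_lt => /(_ 0 xi).
by apply: filterS => z /= zi /FsetP /(_ i); rewrite leNgt zi.
Qed.

(** The bound of [Fset_bounded] is locally uniform, so upper semicontinuity
    applies to some point of each nearby non-empty [Fset]. *)
Lemma near_Fset_meets v (N : set R) : open N -> Fset s v `<=` N ->
  \forall w \near v, Wset s w -> exists2 x, Fset s w x & N x.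
Proof.
move=> oN FN.
near=> w => -[x Fx].
have wv : root_bound w <= root_bound v + 1 by near: w; exact: near_root_bound.
have [y Fy yM] := Fset_bounded Fx wv.
exists y => //; move: y yM Fy; near: w; exact: near_Fset_subset.
Unshelve. all: by end_near. Qed.

Lemma Vset_sub_Wset : Vset s `<=` @Wset R d s.
Proof. by move=> v [x Ux]; exists x; exact: Uset_sub_Fset. Qed.

Lemma open_Vset : open (@Vset R d s).
Proof.
rewrite openE => v [x /near_param_Uset Ux]; rewrite /interior.
by apply: filterS Ux => w Uw; exists x.
Qed.

Lemma closed_Wset : closed (@Wset R d s).
Proof.
rewrite -openC openE => v nW; rewrite /interior.
have : Fset s v `<=` set0 by move=> x Fx; apply: nW; exists x.
move=> /(near_Fset_meets open0); apply: filterS => w /[apply] -[x _ []].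
Qed.

Lemma root_starP v x : root (star v) x <->
  exists i : 'I_d, root (normalized_deriv v i.+1) x.
Proof.
rewrite /star big_add1 /= big_mkord rootE horner_prod; split.
  by move=> /prodf_eq0[i _ ri]; exists i.
by move=> [i ri]; apply/prodf_eq0; exists i.
Qed.

Lemma star_neq0 v : star v != 0.
Proof.
rewrite /star big_add1 /= big_mkord; apply/prodf_neq0 => i _.
exact: normalized_deriv_neq0.
Qed.

(** By convexity all points in between have the weak signs, and all but finitely
    many of them are not roots of [star v]. *)
Lemma Uset_between v x y : Fset s v x -> Fset s v y -> x < y ->
  exists2 z, x < z < y & Uset s v z.
Proof.
move=> Fx Fy xy.
have xn := polyrcf.next_root_gt xy (star_neq0 v).
have ny : polyrcf.next_root (star v) x y <= y.
  by have := polyrcf.next_root_in (star v) x y;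
    rewrite in_itv/= (max_idPl (ltW xy)) => /andP[].
have [xz zn] := midf_lt xn; set z := _ / 2 in xz zn.
have zy := lt_le_trans zn ny.
exists z; first by rewrite xz.
apply: Uset_nonroot; first by apply: (is_interval_Fset Fx Fy); rewrite !ltW.
move=> i; apply/negP => ri.
have := @polyrcf.next_noroot _ (star v) x y z;
  rewrite in_itv/= xz zn => /(_ isT)/negP; apply.
by apply/root_starP; exists i.
Qed.

Lemma continuous_rV (T : topologicalType) (f : T -> 'rV[R]_d) :
  (forall k, continuous (fun t => f t 0 k)) -> continuous f.
Proof.
move=> cf t; apply/cvg_ballP => e e0.
have := @filter_forall _ _ (fun k (x : T) =>
  ball (f t 0 k) e (f x 0 k)) (nbhs t) _
  (fun k => cvg_ball (cf k t) e0).
move=> /(_ (nbhs_filter t) (nbhs_filter t)) h.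
apply: (@filterS _ (nbhs t) (nbhs_filter t) _ _ _ h) => z fz; split => // i k;
  rewrite (ord1 i); exact: fz.
Qed.

End Topology.

(** * Perturbations and translations: density, interior, connectedness *)

Lemma derivn_comp_XaddC (A : comNzRingType) (p : {poly A}) (a : A) m :
  (p \Po ('X + a%:P))^`(m) = p^`(m) \Po ('X + a%:P).
Proof.
by elim: m => [|m IH];
  rewrite ?derivn0// !derivnS IH deriv_comp derivD derivX derivC addr0 mulr1.
Qed.

Section Affine.
Context {R : realType} {d : nat} (s : d.-tuple bool).
Implicit Types (v u w : 'rV[R]_d) (i : 'I_d) (x y a e : R).

(** The linear part of the affine map [v |-> sderiv s v i]. *)
Definition sderiv_lin i u : {poly R} :=
  (sgn (tnth s i) * (d ^_ (d - i.+1))%:R^-1) *: (rVpoly u)^`(d - i.+1).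

Lemma sderiv_affine v u e i : sderiv s (v + e *: u) i = sderiv s v i + e *:
  sderiv_lin i u.
Proof.
rewrite /sderiv /sderiv_lin !normalized_derivE// /monic_poly !linearD/=
  !linearZ/=.
rewrite addrA !scalerA; congr (_ + _ *: _).
by rewrite mulrAC [_^-1 * sgn _]mulrC.
Qed.

Lemma horner_sderiv_affine v u e i x :
  (sderiv s (v + e *: u) i).[x] = (sderiv s v i).[x] + e * (sderiv_lin i u).[x].
Proof. by rewrite sderiv_affine hornerD [(e *: _).[x]]hornerZ. Qed.

(** Translated to [a = 0], the coefficients are the derivatives up to positive
    factors, so one just prescribes their signs. The coefficient of index [k]
    governs the derivative of degree [d - k], hence [rev_ord]. *)
Lemma exists_direction a : exists u, forall i, 0 < (sderiv_lin i u).[a].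
Proof.
pose w : 'rV[R]_d := \row_k sgn (tnth s (rev_ord k)).
pose q := rVpoly w \Po ('X - a%:P).
have sq : (size q <= d)%N.
  by rewrite size_comp_poly2 ?size_XsubC// size_poly.
exists (poly_rV q) => i;
  rewrite /sderiv_lin poly_rV_K// /q -polyCN derivn_comp_XaddC.
rewrite hornerZ horner_comp !hornerE subrr horner_coef0 coef_derivn addn0
  ffactnn.
rewrite (_ : (d - i.+1)%N = rev_ord i)// coef_rVpoly_ord mxE rev_ordK.
rewrite mulrAC divr_gt0 ?ltr0n ?ffact_gt0 ?leq_subr//.
rewrite mulrnAr (_ : _ * _ = 1) ?pmulrn_lgt0 ?fact_gt0//.
by rewrite -[X in _ * X]mulr1 sgnK.
Qed.

Lemma sderiv0 i : (sderiv s (0 : 'rV[R]_d) i).[0] = 0.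
Proof.
rewrite sderivE normalized_derivE// /monic_poly linear0 addr0 derivnXn hornerZ
  hornerMn hornerXn.
by rewrite subKn// expr0n/= mul0rn !mulr0.
Qed.

Definition translate a v : 'rV[R]_d :=
  poly_rV (monic_poly v \Po ('X + a%:P) - 'X^d).

Lemma monic_poly_translate a v : monic_poly (translate a v) = monic_poly v \Po
  ('X + a%:P).
Proof.
have [w wE] : exists w : 'rV[R]_d, monic_poly v \Po ('X + a%:P) = gmonic w.
  apply: gmonic_surj.
    by rewrite monicE lead_coef_comp ?size_XaddC// lead_coefXaddC expr1n mulr1
      -monicE monic_gmonic.
  by rewrite size_comp_poly2 ?size_XaddC ?size_gmonic.
by rewrite /translate wE {1}/gmonic addrAC subrr add0r rVpolyK.
Qed.

Lemma sderiv_translate a v i : sderiv s (translate a v) i = sderiv s v i \Po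
  ('X + a%:P).
Proof.
rewrite /sderiv !normalized_derivE// monic_poly_translate derivn_comp_XaddC.
by rewrite !comp_polyZ.
Qed.

Lemma monic_poly_inj : injective (@monic_poly R d).
Proof. exact: gmonic_inj. Qed.

Lemma translate0 v : translate 0 v = v.
Proof. by apply: monic_poly_inj;
  rewrite monic_poly_translate addr0 comp_polyXr. Qed.

Lemma translateD a b v : translate a (translate b v) = translate (a + b) v.
Proof.
apply: monic_poly_inj; rewrite !monic_poly_translate -comp_polyA.
by rewrite [X in _ \Po X]comp_polyD comp_polyX comp_polyC -addrA -polyCD.
Qed.

Lemma continuous_coef_XaddC_exp j k : continuous (fun a =>
  (('X + a%:P) ^+ j)`_k : R).
Proof.
elim: j k => [|j IH] k.
  under eq_fun do rewrite expr0; exact: continuous_cst.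
rewrite (_ : (fun _ => _) = fun a : R =>
  (if k is k'.+1 then (('X + a%:P) ^+ j)`_k' else 0)
  + (('X + a%:P) ^+ j)`_k * a).
  apply: continuous_add; first by case: k => [|k];
    [exact: continuous_cst|exact: IH].
  by apply: continuous_mul => //; move=> x; exact: cvg_id.
by apply/funext => a; rewrite exprSr mulrDr coefD coefMC coefMX; case: k.
Qed.

Lemma continuous_translate v : continuous (translate ^~ v).
Proof.
apply: continuous_rV => k.
rewrite (_ : (fun _ => _) = fun a =>
  \sum_(j < d.+1) (monic_poly v)`_j * (('X + a%:P) ^+ j)`_k).
  apply: continuous_big => [|j _]; first exact: add_continuous.
  by apply: continuous_mul;
    [exact: continuous_cst|exact: continuous_coef_XaddC_exp].
apply/funext => a.
rewrite -[LHS]coef_gmonic (monic_poly_translate a v : gmonic _ = _).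
by rewrite coef_comp_poly size_gmonic.
Qed.

(** This covers the weak and the strict signs at once. For each polynomial [v]
    with the required signs at 0, the segment from a fixed such polynomial [b]
    to [v], together with all the translates of [v], is connected; these sets
    share [b] and fill the whole set. *)
Lemma connected_sign_sets (K : set R) : is_interval K ->
  [set x | 0 < x] `<=` K ->
  connected [set v | exists x, forall i, K (sderiv s v i).[x]].
Proof.
move=> Kint Kpos.
have [b bpos] := exists_direction 0.
have bK i : 0 < (sderiv s b i).[0].
  by rewrite -[b]add0r -[b]scale1r horner_sderiv_affine sderiv0 add0r mul1r.
pose C : set 'rV[R]_d := [set v | forall i, K (sderiv s v i).[0]].
pose A v : set 'rV[R]_d :=
  ((fun t : R => b + t *: (v - b)) @` `[0, 1]) `|` ((translate ^~ v) @` setT).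
rewrite (_ : [set v | _] = \bigcup_(v in C) A v).
  apply: bigcup_connected.
    exists b => v Cv; left; exists 0; rewrite ?scale0r ?addr0//=.
    by rewrite in_itv/= lexx ler01.
  move=> v Cv; apply: connectedU.
  - exists v; split; last by exists 0 => //; exact: translate0.
    by exists 1; rewrite ?scale1r ?subrKC//= in_itv/= lexx ler01.
  - apply: connected_continuous_connected; first exact: segment_connected.
    apply: continuous_subspaceT => t; apply: cvgD; first exact: cvg_cst.
    by apply: cvgZl; exact: cvg_id.
  - apply: connected_continuous_connected; first by apply/connected_intervalP.
    by apply: continuous_subspaceT; exact: continuous_translate.
apply/seteqP; split => v /=.
  move=> [x Kx]; exists (translate x v).
    by move=> i; rewrite sderiv_translate horner_comp;
      rewrite hornerD hornerX hornerC add0r.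
  by right; exists (- x) => //=; rewrite translateD addNr translate0.
move=> [w Cw [[t]|[a _ <-]]].
  rewrite /= in_itv/= => /andP[t0 t1] <-; exists 0 => i.
  have wE : sderiv s w i = sderiv s b i + 1 *: sderiv_lin i (w - b).
    by rewrite -sderiv_affine scale1r subrKC.
  have bi := bK i.
  rewrite horner_sderiv_affine.
  have := Cw i; rewrite wE scale1r hornerD => Kw.
  set l := (sderiv_lin i (w - b)).[0] in Kw *.
  have [l0|l0] := leP 0 l; first by apply: Kpos; apply: ltr_wpDr => //;
    exact: mulr_ge0.
  apply: (Kint _ _ Kw (Kpos _ bi)); apply/andP; split.
    by rewrite lerD2l ler_niMl// ltW.
  by rewrite gerDl mulr_ge0_le0// ltW.
exists (- a) => i; rewrite sderiv_translate horner_comp.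
by rewrite hornerD hornerX hornerC addNr; exact: Cw.
Qed.

Lemma connected_Vset : connected (@Vset R d s).
Proof.
rewrite (_ : Vset s = [set v | exists x, forall i,
  [set y | 0 < y] (sderiv s v i).[x]]).
  apply: connected_sign_sets => //.
  by move=> x y /= x0 _ z /andP[xz _]; exact: lt_le_trans xz.
by apply/seteqP; split => v [x]; rewrite ?UsetP => Ux; exists x; rewrite ?UsetP.
Qed.

Lemma connected_Wset : connected (@Wset R d s).
Proof.
rewrite (_ : Wset s = [set v | exists x, forall i,
  [set y | 0 <= y] (sderiv s v i).[x]]).
  apply: connected_sign_sets => [|x /ltW//].
  by move=> x y /= x0 _ z /andP[xz _]; exact: le_trans xz.
by apply/seteqP; split => v [x]; rewrite ?FsetP => Ux; exists x; rewrite ?FsetP.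
Qed.

Lemma near_perturb v u (P : set 'rV[R]_d) : (\forall w \near v, P w) ->
  exists2 e, 0 < e & P (v + e *: u).
Proof.
move=> Pv.
have h : (fun e : R => v + e *: u) @ 0 --> v + 0 *: u.
  by apply: cvgD; [exact: cvg_cst|apply: cvgZl; exact: cvg_id].
rewrite scale0r addr0 in h.
have /nbhs_ballP[e e0 he] := h _ Pv.
exists (e / 2); first by rewrite divr_gt0.
apply: he; rewrite /ball/= sub0r normrN gtr0_norm ?divr_gt0//.
by rewrite ltr_pdivrMr// ltr_pMr// ltr1n.
Qed.

Lemma closure_Vset : closure (@Vset R d s) = Wset s.
Proof.
apply/seteqP; split.
  rewrite [X in _ `<=` X](closure_id _).1; last exact: closed_Wset.
  exact/closure_subset/Vset_sub_Wset.
move=> v [x /FsetP Fx] B Bv; have [u uP] := exists_direction x.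
have [e e0 Be] := near_perturb u Bv.
exists (v + e *: u); split => //; exists x; apply/UsetP => i.
by rewrite horner_sderiv_affine ltr_wpDl// mulr_gt0.
Qed.

(** If [v] is interior to [Wset] but not in [Vset], its [Fset] is a single point
    [a]; a polynomial [v - e *: u] in [Wset] has a point of its [Fset] near [a],
    and that point has strict signs for [v]. *)
Lemma interior_Wset : interior (@Wset R d s) = Vset s.
Proof.
apply/seteqP; split; last first.
  by rewrite -open_subsetE; [exact: Vset_sub_Wset|exact: open_Vset].
move=> v; rewrite /interior /= => Wv; apply: contrapT => nV.
have [a Fa] : Wset s v by exact: nbhs_singleton.
have [u uP] := exists_direction a.
pose N := [set x | forall i, 0 < (sderiv_lin i u).[x]].
have oN : open N.
  rewrite openE => x Nx.
  have := @filter_forall _ _ (fun i (y : R) =>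
    0 < (sderiv_lin i u).[y]) (nbhs x) _.
  move=> /(_ (nbhs_filter x)); apply => i.
  by have := @continuous_horner R (sderiv_lin i u) x => /cvgr_gt; apply;
    exact: Nx.
have FN : Fset s v `<=` N.
  move=> x Fx; suff -> : x = a by exact: uP.
  apply: contrapT => /eqP; rewrite neq_lt => /orP[] xa; apply: nV.
    by have [z _ Uz] := Uset_between Fx Fa xa; exists z.
  by have [z _ Uz] := Uset_between Fa Fx xa; exists z.
have [e e0 [We /(_ We)[x /FsetP Fx Nx]]] :=
  near_perturb (- u) (filterI Wv (near_Fset_meets oN FN)).
apply: nV; exists x; apply/UsetP => i.
have := Fx i; rewrite scalerN -scaleNr horner_sderiv_affine mulNr subr_ge0.
by apply: lt_le_trans; rewrite mulr_gt0//; exact: Nx.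
Qed.
End Affine.

(** * Rational semialgebraicity *)

Section SemialgebraicSets.
Context {R : realType} {d : nat} (s : d.-tuple bool).

Definition generic_sderiv n (h : 'I_d -> 'I_n) (i : 'I_d) : {poly ratpoly n} :=
  (if tnth s i then generic_deriv h i.+1 else - generic_deriv h i.+1).

Lemma map_generic_sderiv n (h : 'I_d -> 'I_n) (v : 'rV[R]_n) i :
  map_poly (rateval v) (generic_sderiv h i) = sderiv s (\row_k v 0 (h k)) i.
Proof.
rewrite /generic_sderiv /sderiv /sgn; case: (tnth s i);
by rewrite ?rmorphN/= map_generic_deriv// ?scale1r ?scaleN1r.
Qed.

Lemma row_id (v : 'rV[R]_d) : \row_k v 0 k = v.
Proof. by apply/rowP => k; rewrite mxE. Qed.

Lemma Qsemialgebraic_Wset : Qsemialgebraic (@Wset R d s).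
Proof.
have := @Qsemialgebraic_exists R d 'I_d void (generic_sderiv id) (of_void _).
set A := [set _ | _]; suff -> : A = Wset s by [].
apply/seteqP; split => v; rewrite /A /=.
  by move=> [x [Fx _]]; exists x; apply/FsetP => i; have := Fx i;
    rewrite map_generic_sderiv row_id.
by move=> [x /FsetP Fx]; exists x; split => // i;
  rewrite map_generic_sderiv row_id.
Qed.

Lemma Qsemialgebraic_Vset : Qsemialgebraic (@Vset R d s).
Proof.
have := @Qsemialgebraic_exists R d void 'I_d (of_void _) (generic_sderiv id).
set A := [set _ | _]; suff -> : A = Vset s by [].
apply/seteqP; split => v; rewrite /A /=.
  by move=> [x [_ Fx]]; exists x; apply/UsetP => i; have := Fx i;
    rewrite map_generic_sderiv row_id.
by move=> [x /UsetP Fx]; exists x; split => // i;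
  rewrite map_generic_sderiv row_id.
Qed.

End SemialgebraicSets.

(** * Finite end-points *)

Section Endpoint.
(** Left and right end-points are treated together: [f v] is the least element
    of [Fset s v] when [b] is [true], and the greatest when [b] is [false]. *)
Context {R : realType} {d : nat} (s : d.-tuple bool) (b : bool).
Variable (f : 'rV[R]_d -> R).
Hypothesis fF : forall v, Wset s v -> Fset s v (f v).
Hypothesis fmin : forall v x, Fset s v x -> sgn b * f v <= sgn b * x.
Implicit Types (v w : 'rV[R]_d).

(** Otherwise all signs at [f v] would be strict, and they would stay so a
    little beyond [f v]. *)
Lemma endpoint_root v : Wset s v -> root (star v) (f v).
Proof.
move=> Wv; apply: contrapT => nr.
have /near_point_Uset/nbhs_ballP[e e0 Ue] : Uset s v (f v).
  apply: Uset_nonroot; first exact: fF.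
  by move=> i; apply/negP => ri; apply: nr; apply/root_starP; exists i.
have := fmin (Uset_sub_Fset (Ue (f v - sgn b * (e / 2)) _)).
rewrite mulrBr sgnK lerBrDr gerDl => h;
  have : ~~ (e / 2 <= 0) by rewrite -ltNge divr_gt0.
move=> /negP; apply; apply: h.
rewrite /ball/= opprB addrC subrK normrM normr_sgn.
by rewrite mul1r gtr0_norm ?divr_gt0// ltr_pdivrMr// ltr_pMr// ltr1n.
Qed.

Lemma endpoint_le_root_bound v : Wset s v -> `|f v| <= root_bound v.
Proof.
move=> /endpoint_root /root_starP[i]; exact: root_le_root_bound.
Qed.

Lemma near_endpoint v (N : set R) : open N -> Fset s v `<=` N ->
  \forall w \near v, Wset s w -> N (f w).
Proof.
move=> oN FN; near=> w => Ww.
suff H : forall x, x \in `[- (root_bound v + 1), root_bound v + 1] ->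
  Fset s w x -> N x.
  apply: H; last exact: fF.
  rewrite in_itv/= -ler_norml (le_trans (endpoint_le_root_bound Ww))//.
  by near: w; exact: near_root_bound.
by near: w; exact: near_Fset_subset.
Unshelve. all: by end_near. Qed.

(** Nearby end-points cannot go far beyond [f v], by upper semicontinuity. In
    the other direction, if [Fset s v] is not a point there are points of [Uset
    s v] as close to [f v] as wished, and they remain in [Uset]; if it is a
    point, upper semicontinuity alone suffices. *)
Lemma endpoint_continuous : {within Wset s, continuous f}.
Proof.
apply/subspace_continuousP => v Wv; apply/cvgrPdist_lt => e e0.
rewrite near_withinE.
have [[x [Fx fx]]|nx] :=
  pselect (exists x, Fset s v x /\ sgn b * f v < sgn b * x).
- have [z [Uz fz ze]] : exists z, [/\ Uset s v z,
  sgn b * f v <= sgn b * z & sgn b * z < sgn b * f v + e].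
    pose y := Num.min (sgn b * x) (sgn b * f v + e).
    have fy : sgn b * f v < y by rewrite lt_min fx ltrDl.
    have Fy : Fset s v (sgn b * y).
      have yx : y <= sgn b * x by rewrite ge_min lexx.
      apply: (@is_interval_Fset _ _ s v (Num.min x (f v)) (Num.max x (f v))).
      + by case: leP => _ //; exact: fF.
      + by case: leP => _ //; exact: fF.
      + move: (fx) (fy) (yx); rewrite /sgn; case: (b);
        rewrite ?mul1r ?mulN1r => fx' fy' yx'.
          by rewrite ge_min le_max yx' (ltW fy') orbT.
        rewrite ge_min le_max; apply/andP; split; apply/orP; first by left;
          rewrite lerNr.
        by right; rewrite lerNl ltW.
    have ye : y <= sgn b * f v + e by rewrite ge_min lexx orbT.
    have Ff := fF Wv.
    case: (b) fy Fy ye; rewrite /sgn ?mul1r ?mulN1r => fy Fy ye.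
      have [z /andP[fz zy] Uz] := Uset_between Ff Fy fy.
      by exists z; rewrite !mul1r; split => //;
        [exact: ltW|exact: lt_le_trans ye].
    have yf : - y < f v by rewrite ltrNl.
    have [z /andP[yz zf] Uz] := Uset_between Fy Ff yf.
    exists z; rewrite !mulN1r; split => //; first by rewrite lerN2 ltW.
    by apply: lt_le_trans ye; rewrite ltrNl.
  have oN : open [set x | sgn b * f v - e < sgn b * x].
    apply: (@open_comp _ _ (fun x => sgn b * x) [set x | sgn b * f v - e < x]).
      move=> ? _; apply: (@continuous_mul R R (fun=> sgn b) id);
        first exact: continuous_cst.
      by move=> z0; exact: cvg_id.
    exact: open_gt.
  have FN : Fset s v `<=` [set x | sgn b * f v - e < sgn b * x].
    by move=> x' Fx'; rewrite /= ltrBlDr (le_lt_trans (fmin Fx'))// ltrDl.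
  apply: filterS2 (near_endpoint oN FN) (near_param_Uset Uz) => w h1 Uw Ww.
  have {}h1 := h1 Ww; have h2 := fmin (Uset_sub_Fset Uw).
  have -> : `|f v - f w| = `|sgn b * f v - sgn b * f w|.
    by rewrite -mulrBr normrM normr_sgn mul1r.
  by rewrite distrC ltr_distl h1 (le_lt_trans h2).
- have FN : Fset s v `<=` ball (f v) e.
    move=> x Fx; suff -> : x = f v by exact: ballxx.
    have : sgn b * x = sgn b * f v.
      apply/eqP; rewrite eq_le fmin// andbT leNgt; apply/negP => h.
      by apply: nx; exists x.
    exact: (mulfI (sgn_neq0 b)).
  have := @near_endpoint v (ball (f v) e) (ball_open (f v) e) FN.
  by apply: filterS => w h /h; rewrite /ball/=.
Qed.

(** The monic equation is the product [star] of a generic polynomial. *)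
Lemma endpoint_integral : integral_on (@Wset R d s) f.
Proof.
exists (\prod_(1 <= i < d.+1) generic_deriv id i).
  rewrite big_add1 /= big_mkord; apply: monic_prod => i _;
    exact: monic_generic_deriv.
move=> v Wv; have /rootP := endpoint_root Wv; rewrite /star rmorph_prod/=.
congr (_.[_] = 0); apply: eq_big_nat => i /andP[_ id].
by rewrite map_generic_deriv// row_id.
Qed.

(** The end-point is the point of [Fset] that no point of [Fset] precedes. *)
Lemma endpoint_graph : Qsemialgebraic (graph_on (@Wset R d s) f).
Proof.
pose h : 'I_d -> 'I_(d + 1) := lshift 1.
pose X : ratpoly (d + 1) := mpoly.mpolyX rat (mpoly.mnm1 (rshift d ord0)).
have hE (u : 'rV[R]_(d + 1)) : \row_k u 0 (h k) = lsubmx u.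
  by apply/rowP => k; rewrite !mxE.
have XE (u : 'rV[R]_(d + 1)) : rateval u X = rsubmx u 0 0.
  by rewrite ratevalX !mxE.
have QF : Qsemialgebraic
    [set u : 'rV[R]_(d + 1) | Fset s (lsubmx u) (rsubmx u 0 0)].
  have := @Qsemialgebraic_exists R (d + 1) 'I_d void (fun i =>
    ((generic_sderiv s h i).[X])%:P) (of_void _).
  set A := [set _ | _]; set B := [set _ | _]; suff -> : A = B by [].
  apply/seteqP; split => u; rewrite /A /B /=.
    move=> [x [Fx _]]; apply/FsetP => i; have := Fx i.
    by rewrite -XE map_polyC hornerC/= -horner_map map_generic_sderiv hE.
  move=> /FsetP + ; rewrite -XE => Fx; exists 0; split => // i.
  by rewrite map_polyC hornerC/= -horner_map map_generic_sderiv hE.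
have QE : Qsemialgebraic [set u : 'rV[R]_(d + 1) | exists y,
  Fset s (lsubmx u) y /\
    sgn b * y < sgn b * rsubmx u 0 0].
  have := @Qsemialgebraic_exists R (d + 1) 'I_d unit (generic_sderiv s h)
    (fun _ => if b then X%:P - 'X else 'X - X%:P).
  set A := [set _ | _]; set B := [set _ | _]; suff -> : A = B by [].
  have pE (u : 'rV[R]_(d + 1)) y :
    (0 < (map_poly (rateval u) (if b then X%:P - 'X else 'X - X%:P)).[y]) =
    (sgn b * y < sgn b * rsubmx u 0 0).
    rewrite -XE /sgn; case: (b);
      rewrite rmorphB/= map_polyC map_polyX hornerD hornerN hornerX hornerC.
      by rewrite !mul1r subr_gt0.
    by rewrite !mulN1r ltrN2 subr_gt0.
  apply/seteqP; split => u; rewrite /A /B /=.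
    move=> [x [Fx /(_ tt)]]; rewrite pE => ?; exists x; split => //.
    by apply/FsetP => i; have := Fx i; rewrite map_generic_sderiv hE.
  move=> [x [/FsetP Fx ?]]; exists x; split => [i|_]; last by rewrite pE.
  by rewrite map_generic_sderiv hE.
suff -> : graph_on (Wset s) f = [set u : 'rV[R]_(d + 1) | Fset s (lsubmx u)
  (rsubmx u 0 0)]
  `&` ~` [set u : 'rV[R]_(d + 1) | exists y, Fset s (lsubmx u) y /\
    sgn b * y < sgn b * rsubmx u 0 0].
  by apply: Qsemialg_setI => //; exact: Qsemialg_setC.
apply/seteqP; split => u /=.
  move=> [Wu ->]; split; first exact: fF.
  by move=> [y [Fy]]; rewrite ltNge fmin.
move=> [Fu nu]; have Wu : Wset s (lsubmx u) by exists (rsubmx u 0 0).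
split => //; apply: (mulfI (sgn_neq0 b)); apply/eqP; rewrite eq_le fmin// andbT.
by rewrite leNgt; apply/negP => h'; apply: nu; exists (f (lsubmx u));
  split => //; exact: fF.
Qed.

Lemma endpoint_integral_continuous : integral_continuous_on (@Wset R d s) f.
Proof.
split; [exact: endpoint_continuous|exact: endpoint_graph|exact:
  endpoint_integral].
Qed.

End Endpoint.

(** * Infinite end-points and conclusion *)

Lemma closed_inf (R : realType) (A : set R) : closed A -> A !=set0 ->
  has_lbound A -> A (inf A).
Proof.
move=> cA A0 lA; apply: cA => B /nbhs_ballP[e e0 Be].
have [x Ax xe] := inf_adherent e0 (conj A0 lA).
exists x; split => //; apply: Be;
  rewrite /ball/= distrC ger0_norm ?subr_ge0 ?ge_inf//.
by rewrite ltrBlDl.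
Qed.

Lemma closed_sup (R : realType) (A : set R) : closed A -> A !=set0 ->
  has_ubound A -> A (sup A).
Proof. by move=> cA A0 uA; apply: cA; exact: closure_sup. Qed.

Section InfiniteEnds.
Context {R : realType} {d : nat} (s : d.-tuple bool).
Implicit Types (v : 'rV[R]_d) (x : R).

(** An unbounded [Fset] reaches beyond [root_bound], where only one list of
    signs is possible; for that list it contains a whole half-line. *)
Lemma right_end_pinfty v : Wset s v ->
  right_end s v = +oo%E <-> forall i, tnth s i = true.
Proof.
move=> Wv; split=> [roo|sT].
  have : (ereal_sup (EFin @` Fset s v) > (root_bound v)%:E)%E.
    by rewrite -/(right_end s v) roo ltry.
  by move=> /ereal_sup_gt[_ [x Fx <-]];
    rewrite lte_fin => /ltW /(Fset_right_signs Fx).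
apply/eqP; rewrite -leye_eq leNgt; apply/negP => lty.
have ub x : Fset s v x -> (x%:E <= right_end s v)%E.
  by move=> Fx; apply: ereal_sup_ubound; exists x.
have rF : right_end s v \is a fin_num.
  rewrite fin_numE -ltey -ltNye lty andbT.
  by have [x Fx] := Wv; apply: lt_le_trans (ub _ Fx); exact: ltNyr.
have := ub (Num.max (root_bound v) (fine (right_end s v) + 1))
  (Fset_right_ray sT _).
rewrite le_max lexx => /(_ isT).
by rewrite -(fineK rF) lee_fin ge_max gerDl ler10 andbF.
Qed.

Lemma left_end_minfty v : Wset s v ->
  left_end s v = -oo%E <-> forall i, tnth s i = ~~ odd i.+1.
Proof.
move=> Wv; split=> [loo|sT].
  have : (ereal_inf (EFin @` Fset s v) < (- root_bound v)%:E)%E.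
    by rewrite -/(left_end s v) loo ltNyr.
  by move=> /ereal_inf_lt[_ [x Fx <-]];
    rewrite lte_fin => /ltW /(Fset_left_signs Fx).
apply/eqP; rewrite -leeNy_eq leNgt; apply/negP => Nylt.
have lb x : Fset s v x -> (left_end s v <= x%:E)%E.
  by move=> Fx; apply: ereal_inf_lbound; exists x.
have lF : left_end s v \is a fin_num.
  rewrite fin_numE -ltey -ltNye Nylt /=.
  by have [x Fx] := Wv; apply: le_lt_trans (lb _ Fx) _; exact: ltry.
have := lb (Num.min (- root_bound v) (fine (left_end s v) - 1))
  (Fset_left_ray sT _).
rewrite ge_min lexx => /(_ isT).
by rewrite -(fineK lF) lee_fin le_min lerBrDr gerDl ler10 andbF.
Qed.

Lemma left_end_min v : ~ (forall i, tnth s i = ~~ odd i.+1) -> Wset s v ->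
  exists a, [/\ left_end s v = a%:E, Fset s v a & forall x, Fset s v x ->
    a <= x].
Proof.
move=> sN Wv; have lF : has_lbound (Fset s v).
  exists (- root_bound v) => x Fx; rewrite leNgt; apply/negP => /ltW xr.
  exact/sN/(Fset_left_signs Fx).
exists (inf (Fset s v)); split; first by rewrite /left_end ereal_inf_EFin.
  by apply: closed_inf => //; exact: closed_Fset.
by move=> x Fx; exact: ge_inf.
Qed.

Lemma right_end_max v : ~ (forall i, tnth s i = true) -> Wset s v ->
  exists a, [/\ right_end s v = a%:E, Fset s v a & forall x, Fset s v x ->
    x <= a].
Proof.
move=> sN Wv; have uF : has_ubound (Fset s v).
  exists (root_bound v) => x Fx; rewrite leNgt; apply/negP => /ltW xr.
  exact/sN/(Fset_right_signs Fx).
exists (sup (Fset s v)); split; first by rewrite /right_end ereal_sup_EFin.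
  by apply: closed_sup => //; exact: closed_Fset.
by move=> x Fx; exact: ub_le_sup.
Qed.

Lemma finite_end (e : 'rV[R]_d -> \bar R) (b : bool) :
  (forall v, Wset s v -> exists a, [/\ e v = a%:E, Fset s v a
     & forall x, Fset s v x -> sgn b * a <= sgn b * x]) ->
  [/\ forall v, Wset s v -> e v \is a fin_num,
      integral_continuous_on (Wset s) (fun v => fine (e v))
    & forall v, Wset s v -> root (star v) (fine (e v))].
Proof.
move=> eP.
have fF v : Wset s v -> Fset s v (fine (e v)).
  by move=> /eP[a [-> Fa _]].
have fmin v x : Fset s v x -> sgn b * fine (e v) <= sgn b * x.
  by move=> Fx; have [|a [-> _]] := eP v; [exists x|exact].
split.
- by move=> v /eP[a [-> _ _]].
- exact: endpoint_integral_continuous fF fmin.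
- exact: endpoint_root fF fmin.
Qed.

End InfiniteEnds.

Theorem theorem6p1 (R : realType) (d : nat) (s : d.-tuple bool)
    (d_gt0 : (0 < d)%N) :
  let W : set 'rV[R]_d := Wset s in
  let V : set 'rV[R]_d := Vset s in
  [/\ (* (1) *)
      [/\ connected W, closed W, Qsemialgebraic W & interior W = V],
      (* (2) *)
      [/\ connected V, open V, Qsemialgebraic V & closure V = W],
      (* (3) *)
      (forall P, W P ->
         [/\ Fset s P !=set0, is_interval (Fset s P) & closed (Fset s P)]) /\
      (forall e : 'rV[R]_d -> \bar R, e = left_end s \/ e = right_end s ->
         (exists2 P, W P & e P \is a fin_num) ->
         [/\ forall P, W P -> e P \is a fin_num,
             integral_continuous_on W (fun P => fine (e P))
           & forall P, W P -> root (star P) (fine (e P))])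
    & (* (4) *)
      forall P, W P ->
        (right_end s P = +oo%E <-> forall i : 'I_d, tnth s i = true) /\
        (left_end s P = -oo%E <-> forall i : 'I_d, tnth s i = ~~ odd i.+1)].
Proof.
move=> W V; split.
- split; [exact: connected_Wset|exact: closed_Wset|exact:
  Qsemialgebraic_Wset|exact: interior_Wset].
- split; [exact: connected_Vset|exact: open_Vset|exact:
  Qsemialgebraic_Vset|exact: closure_Vset].
- split=> [P WP|e [->|->] [P WP eP]].
  + by split=> //; [exact: is_interval_Fset|exact: closed_Fset].
  + apply: (@finite_end _ _ _ _ true) => v Wv.
    have [|a [aE Fa ax]] := @left_end_min _ _ s v _ Wv.
      by move=> /(left_end_minfty WP) loo; rewrite loo in eP.
    by exists a; split => // x Fx; rewrite !mul1r ax.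
  + apply: (@finite_end _ _ _ _ false) => v Wv.
    have [|a [aE Fa ax]] := @right_end_max _ _ s v _ Wv.
      by move=> /(right_end_pinfty WP) roo; rewrite roo in eP.
    by exists a; split => // x Fx; rewrite !mulN1r lerN2 ax.
- by move=> P WP; split; [exact: right_end_pinfty|exact: left_end_minfty].
Qed.
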